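(* Let $D$ be a finite digraph, possibly with loops but without multiple arcs. Let $S(D)$ be its subdivision digraph and let $N(D)$ be the union of $D$ and $S(D)$. Let $v$, $A$, $B$ denote respectively the number of vertices, the number of sinks and the number of sources of $D$. Then $$i(N(D)) = i(S(D)) = 2v - A - B,$$ where $i(\cdot)$ denotes the intersection number of a digraph.
   Context: Digraphs are finite, may have loops, and have no multiple arcs; $V(D)$ and $E(D)$ are the vertex set and arc set. A source is a vertex with no incoming arcs and a sink is a vertex with no outgoing arcs; loops count as both incoming and outgoing arcs, so a vertex with a loop is neither a source nor a sink. Intersection number: given a set $U$ and a family of ordered pairs $(S_x,T_x)$ of subsets of $U$ indexed by the vertices $x$ of a digraph $H$, the digraph $H$ is the intersection digraph of this family if for all vertices $x,y$ (possibly equal) $(x,y)$ is an arc of $H$ iff $S_x\cap T_y\neq\emptyset$. The intersection number $i(H)$ is the minimum size of a set $U$ such that $H$ is the intersection digraph of a family of ordered pairs of subsets of $U$. Subdivision digraph $S(D)$: obtained by placing a vertex on every arc of $D$; its vertex set is $V(D)\cup E(D)$ (disjoint union) and for each arc $e=(u,w)$ of $D$ (including loops, $u=w$) it has the arcs $(u,e)$ and $(e,w)$, and no others. $N(D)$: the digraph with vertex set $V(D)\cup E(D)$ in which $(a,b)$ is an arc iff $(a,b)$ is an arc of $D$ or of $S(D)$. *)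

(* Defs.v *)
From mathcomp Require Import all_boot.

Set Implicit Arguments.
Unset Strict Implicit.
Unset Printing Implicit Defensive.

(* A finite digraph, loops allowed and multiple arcs excluded, is an arbitrary *)
(* relation D : rel V on a finType V: D u w is the arc (u, w).                 *)

Section Digraph.

Variables (V : finType) (D : rel V).

(* A loop at x is both an incoming and an outgoing arc of x, so y = x is *)
(* deliberately not excluded.                                            *)
Definition is_source (x : V) : bool := [forall y, ~~ D y x].
Definition is_sink (x : V) : bool := [forall y, ~~ D x y].

Definition sources : {set V} := [set x | is_source x].
Definition sinks : {set V} := [set x | is_sink x].

Definition arc : finType := {p : V * V | D p.1 p.2}.

Definition arc_tail (a : arc) : V := (val a).1.
Definition arc_head (a : arc) : V := (val a).2.

Definition subdivision_digraph : rel (V + arc) := fun a b =>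
  match a, b with
  | inl u, inr e => u == arc_tail e
  | inr e, inl w => w == arc_head e
  | _, _ => false
  end.

(* D itself, regarded as a set of arcs on the larger vertex set. *)
Definition lifted_digraph : rel (V + arc) := fun a b =>
  match a, b with
  | inl u, inl w => D u w
  | _, _ => false
  end.

Definition N_digraph : rel (V + arc) := fun a b =>
  lifted_digraph a b || subdivision_digraph a b.

End Digraph.

Arguments subdivision_digraph {V} D a b.
Arguments lifted_digraph {V} D a b.
Arguments N_digraph {V} D a b.

Section IntersectionNumber.

Variables (W : finType) (H : rel W).

Definition is_intersection_digraph (U : finType) (S T : W -> {set U}) : Prop :=
  forall x y : W, H x y <-> S x :&: T y != set0.

(* Boolean form for the standard k-element set 'I_k, so that a minimum can be *)
(* taken; intersection_representableP covers every U of cardinality k.        *)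
Definition intersection_representable (k : nat) : bool :=
  [exists S : {ffun W -> {set 'I_k}}, exists T : {ffun W -> {set 'I_k}},
     [forall x, forall y, H x y == (S x :&: T y != set0)]].

Lemma intersection_representableP (k : nat) :
  intersection_representable k <->
  exists U : finType, #|U| = k /\
    exists S T : W -> {set U}, is_intersection_digraph S T.
Proof.
split=> [/existsP[S /existsP[T ST]]|[U [cardU [S [T ST]]]]].
  exists 'I_k; split; first exact: card_ord.
  exists S, T => x y.
  by move/forallP/(_ x)/forallP/(_ y)/eqP: ST => ->.
subst k; pose f := @enum_rank U.
have f_inj : injective f by exact: enum_rank_inj.
apply/existsP; exists [ffun x => f @: S x].
apply/existsP; exists [ffun x => f @: T x].
apply/forallP=> x; apply/forallP=> y; apply/eqP.
rewrite !ffunE -imsetI; last by move=> a b _ _; exact: f_inj.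
by rewrite imset_eq0; apply/idP/idP => /ST.
Qed.

Lemma ex_intersection_representable :
  exists k : nat, intersection_representable k.
Proof.
exists #|{: W * W}|; apply/intersection_representableP.
exists (W * W)%type; split=> //.
exists (fun x => [set p | H p.1 p.2 & p.1 == x]).
exists (fun y => [set p | H p.1 p.2 & p.2 == y]) => x y; split=> [Hxy|].
  by apply/set0Pn; exists (x, y); rewrite !inE /= Hxy !eqxx.
by case/set0Pn=> -[a b]; rewrite !inE /=; case/andP=> /andP[Hab /eqP<-] /andP[_ /eqP<-].
Qed.

Definition intersection_number : nat := ex_minn ex_intersection_representable.

Lemma intersection_numberP (k : nat) :
  intersection_number = k <->
  (exists U : finType, #|U| = k /\
     exists S T : W -> {set U}, is_intersection_digraph S T) /\
  (forall (U : finType) (S T : W -> {set U}),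
     is_intersection_digraph S T -> k <= #|U|).
Proof.
rewrite /intersection_number; case: ex_minnP => m repm minm; split=> [<-|[]].
  split; first exact/intersection_representableP.
  move=> U S T ST; apply: minm; apply/intersection_representableP.
  by exists U; split=> //; exists S, T.
move=> /intersection_representableP repk mink; apply/eqP.
rewrite eqn_leq minm //=.
by case/intersection_representableP: repm => U [<- [S [T /mink]]].
Qed.

End IntersectionNumber.

(* Main.v *)
Require Import Defs.
From mathcomp Require Import all_boot.

(** A non-sink [u] starts an arc [e], so some element lies in [S_u] and [T_e];
    a non-source [w] ends an arc [f], so some element lies in [S_f] and [T_w].
    These elements are pairwise distinct: a coincidence would create an arc
    from a vertex to a subdivision vertex of an arc leaving another vertex (or
    dually), or an arc between two subdivision vertices. Conversely, one element
    for each non-sink and one for each non-source suffice. Arcs of [D] itself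
    play no role in the lower bound and cost nothing in the upper one. *)

Set Implicit Arguments.
Unset Strict Implicit.
Unset Printing Implicit Defensive.

(* [path.arc] shadows the arcs of a digraph. *)
Local Notation arc := Defs.arc.

Section SubdivisionIntersection.

Variables (V : finType) (D : rel V).

Lemma non_sinkP (u : V) : reflect (exists w, D u w) (u \notin sinks D).
Proof.
rewrite inE negb_forall; apply: (iffP existsP) => -[w Duw]; exists w => //.
  exact: negbNE.
by rewrite Duw.
Qed.

Lemma non_sourceP (w : V) : reflect (exists u, D u w) (w \notin sources D).
Proof.
rewrite inE negb_forall; apply: (iffP existsP) => -[u Duw]; exists u => //.
  exact: negbNE.
by rewrite Duw.
Qed.

(** The sum is disjoint: a vertex that is neither a sink nor a source counts twice. *)
Definition arc_end : finType :=
  ({u | u \notin sinks D} + {w | w \notin sources D})%type.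

Lemma card_arc_end : #|arc_end| = 2 * #|V| - #|sinks D| - #|sources D|.
Proof.
have card_compl (A : {set V}) : #|{: {x | x \notin A}}| = #|V| - #|A|.
  by rewrite card_sig -(cardC A) addKn.
(* No subtraction truncates, since each of the two sets has at most [#|V|] elements. *)
by rewrite card_sum !card_compl mul2n -addnn addnBA ?addnBAC ?max_card.
Qed.

(** [H] covers [subdivision_digraph D] and [N_digraph D] at once: only its arcs between original
    vertices are left open. *)
Variable H : rel (V + arc D).
Hypothesis subdivHr : forall x e, H x (inr e) = subdivision_digraph D x (inr e).
Hypothesis subdivHl : forall e y, H (inr e) y = subdivision_digraph D (inr e) y.

Lemma leq_arc_end_intersection (U : finType) (S T : V + arc D -> {set U}) :
  is_intersection_digraph H S T -> #|arc_end| <= #|U|.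
Proof.
move=> ST.
have meet c x y : c \in S x -> c \in T y -> H x y.
  by move=> cS cT; apply/ST/set0Pn; exists c; rewrite inE cS.
pose P (i : arc_end) (c : U) := match i with
  | inl u => c \in S (inl (val u)) /\
             exists2 e : arc D, val u = arc_tail e & c \in T (inr e)
  | inr w => c \in T (inl (val w)) /\
             exists2 e : arc D, val w = arc_head e & c \in S (inr e)
  end.
have exP i : exists c, P i c.
  case: i => [[u nsu]|[w nsw]].
    have /non_sinkP[w Duw] := nsu; pose e : arc D := Sub (u, w) Duw.
    have /ST/set0Pn[c /setIP[cS cT]] : H (inl u) (inr e).
      by rewrite subdivHr /= eqxx.
    by exists c; split=> //; exists e.
  have /non_sourceP[u Duw] := nsw; pose e : arc D := Sub (u, w) Duw.
  have /ST/set0Pn[c /setIP[cS cT]] : H (inr e) (inl w).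
    by rewrite subdivHl /= eqxx.
  by exists c; split=> //; exists e.
have [f fP] := fin_all_exists exP.
apply: (@leq_card _ _ f) => i j fij.
move: (fP i) (fP j); rewrite -{}fij; move: (f i) => c.
case: i j => [u|w] [u'|w'] [ci [e ei ce]] [cj [e' ej ce']].
- move: (meet _ _ _ ci ce'); rewrite subdivHr /= -ej => /eqP eq_u.
  by congr inl; apply: val_inj.
- by move: (meet _ _ _ ce' ce); rewrite subdivHr.
- by move: (meet _ _ _ ce ce'); rewrite subdivHr.
- move: (meet _ _ _ ce' ci); rewrite subdivHl /= -ej => /eqP eq_w.
  by congr inr; apply: val_inj.
Qed.

(** This makes the head of such an arc a non-source, so that it has its own element in [arc_end]. *)
Hypothesis subHD : forall u w, H (inl u) (inl w) -> D u w.

Definition arc_end_out (x : V + arc D) : {set arc_end} :=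
  [set i : arc_end | match x, i with
    | inl u, inl a => val a == u
    | inl u, inr b => H (inl u) (inl (val b))
    | inr e, inr b => val b == arc_head e
    | inr _, inl _ => false
    end].

Definition arc_end_in (y : V + arc D) : {set arc_end} :=
  [set i : arc_end | match y, i with
    | inl w, inr b => val b == w
    | inr e, inl a => val a == arc_tail e
    | _, _ => false
    end].

(** Each [arc_end_in y] has at most one element, and is empty only when [y] is a source of [D]; so
    [x] sends an arc to [y] exactly when [arc_end_out x] contains that element. *)
Lemma arc_end_intersection : is_intersection_digraph H arc_end_out arc_end_in.
Proof.
have tail_ns (e : arc D) : arc_tail e \notin sinks D.
  by apply/non_sinkP; exists (arc_head e); apply: (valP e).
have head_ns (e : arc D) : arc_head e \notin sources D.
  by apply/non_sourceP; exists (arc_tail e); apply: (valP e).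
move=> x y; split.
  case: x y => [u|e] [w|e'] Hxy; apply/set0Pn.
  - have nsw : w \notin sources D.
      by apply/non_sourceP; exists u; apply: subHD.
    by exists (inr (exist _ w nsw)); rewrite !inE /= Hxy eqxx.
  - move: Hxy; rewrite subdivHr /= => /eqP->.
    by exists (inl (exist _ (arc_tail e') (tail_ns e'))); rewrite !inE /= !eqxx.
  - move: Hxy; rewrite subdivHl /= => /eqP->.
    by exists (inr (exist _ (arc_head e) (head_ns e))); rewrite !inE /= !eqxx.
  - by move: Hxy; rewrite subdivHl.
case/set0Pn=> i; rewrite !inE.
case: x y i => [u|e] [w|e'] [a|b] //=; rewrite ?andbF // => /andP[].
- by move=> Huw /eqP <-.
- by move=> /eqP <-; rewrite subdivHr.
- by move=> /eqP eq_b /eqP <-; rewrite subdivHl /= eq_b.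
Qed.

Lemma intersection_number_subdivision :
  intersection_number H = 2 * #|V| - #|sinks D| - #|sources D|.
Proof.
rewrite -card_arc_end; apply/intersection_numberP; split.
  by exists arc_end; split=> //; exists arc_end_out, arc_end_in;
     apply: arc_end_intersection.
exact: leq_arc_end_intersection.
Qed.

End SubdivisionIntersection.

Theorem theorem2 (V : finType) (D : rel V) :
  intersection_number (N_digraph D) = intersection_number (subdivision_digraph D) /\
  intersection_number (subdivision_digraph D) = 2 * #|V| - #|sinks D| - #|sources D|.
Proof.
have iS : intersection_number (subdivision_digraph D)
          = 2 * #|V| - #|sinks D| - #|sources D|.
  exact: intersection_number_subdivision.
(* Only [subHD] is left: between original vertices [N_digraph D] has the arcs of [D]. *)
split=> //; rewrite iS; apply: intersection_number_subdivision => [[]||u w] //.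
by rewrite /N_digraph /= orbF.
Qed.
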